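(* For all integers $k \geq j \geq 2$, $\mathrm{sa}(Q_{2^k+2^j-4}) = 2^{k-1}+2^{j-1}$.
   Context: $Q_n$ denotes the $n$-dimensional hypercube: the graph whose vertices are all binary vectors of length $n$, two vertices being adjacent if and only if they differ in exactly one coordinate. A star is a complete bipartite graph $K_{1,m}$ with $m\ge 1$. A galaxy (star forest) is a union of vertex-disjoint stars. The star arboricity $\mathrm{sa}(G)$ of a finite simple graph $G$ is the minimum number of galaxies (subgraphs of $G$) whose edge sets partition the edge set of $G$. *)

(* Defs.v *)
From mathcomp Require Import all_boot.
Set Implicit Arguments.
Unset Strict Implicit.
Unset Printing Implicit Defensive.

Record sgraph := SGraph {
  vertex :> finType;
  adj : rel vertex;
  adj_sym : symmetric adj;
  adj_irrefl : irreflexive adj }.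

(* An edge is the two-element set of its ends. *)
Definition edges (G : sgraph) : {set {set G}} :=
  [set e | [exists x, exists y, adj x y && (e == [set x; y])]].

(* Subgraphs without isolated vertices are represented by their edge sets;
   the vertex set of such a subgraph S is then [cover S]. *)
Section Stars.
Variable T : finType.
Implicit Types S F : {set {set T}}.

(* The centre is c, and the m >= 1 leaves are the elements of L. *)
Definition star S : bool :=
  [exists c : T, exists L : {set T},
     [&& L != set0, c \notin L & S == [set [set c; l] | l in L]]].

Definition galaxy F : bool :=
  [exists P : {set {set {set T}}},
     [&& [forall S in P, star S],
         [forall S1 in P, forall S2 in P,
            (S1 != S2) ==> [disjoint cover S1 & cover S2]]
       & F == cover P]].

End Stars.

(* [partition] requires nonempty blocks; this does not affect the minimum
   below, since empty galaxies can always be discarded. *)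
Definition galaxy_partition (G : sgraph) (P : {set {set {set G}}}) : bool :=
  partition P (edges G) && [forall F in P, galaxy F].

Lemma star_galaxy (T : finType) (S : {set {set T}}) : star S -> galaxy S.
Proof.
move=> sS; apply/existsP; exists [set S]; apply/and3P; split.
- by apply/forall_inP=> S1 /set1P->.
- apply/forall_inP=> S1 /set1P->; apply/forall_inP=> S2 /set1P->.
  by rewrite eqxx.
- by rewrite /cover big_set1.
Qed.

Lemma edge_star (G : sgraph) (e : {set G}) : e \in edges G -> star [set e].
Proof.
rewrite inE => /existsP[x /existsP[y /andP[xy /eqP->]]].
apply/existsP; exists x; apply/existsP; exists [set y]; apply/and3P; split.
- by apply/set0Pn; exists y; rewrite inE.
- by apply/negP=> /set1P xEy; rewrite xEy adj_irrefl in xy.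
- by rewrite imset_set1.
Qed.

Lemma ex_galaxy_partition (G : sgraph) :
  exists t, [exists P, galaxy_partition (G := G) P && (#|P| == t)].
Proof.
pose P := [set [set e] | e in edges G].
exists #|P|; apply/existsP; exists P; rewrite eqxx andbT; apply/andP; split.
- apply/and3P; split.
  + rewrite eqEsubset; apply/andP; split; apply/subsetP=> e.
      by case/bigcupP=> _ /imsetP[f fE ->] /set1P->.
    by move=> eE; apply/bigcupP; exists [set e]; rewrite ?set11 ?imset_f.
  + apply/trivIsetP=> _ _ /imsetP[e _ ->] /imsetP[f _ ->] ne.
    by rewrite disjoints1 inE; apply: contraNneq ne => ->.
  + by apply/imsetP=> -[e _ /esym/eqP]; rewrite -cards_eq0 cards1.
- by apply/forall_inP=> _ /imsetP[e eE ->]; apply/star_galaxy/edge_star.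
Qed.

Definition sa (G : sgraph) : nat := ex_minn (ex_galaxy_partition G).

Definition Q_adj (n : nat) : rel (n.-tuple bool) :=
  fun x y => #|[set i | tnth x i != tnth y i]| == 1.

Lemma Q_adj_sym n : symmetric (@Q_adj n).
Proof.
move=> x y; congr (_ == 1); apply: eq_card => i.
by rewrite !inE eq_sym.
Qed.

Lemma Q_adj_irrefl n : irreflexive (@Q_adj n).
Proof.
move=> x; apply/negbTE; rewrite /Q_adj.
suff -> : [set i | tnth x i != tnth x i] = set0 by rewrite cards0.
by apply/setP=> i; rewrite !inE eqxx.
Qed.

Definition Q (n : nat) : sgraph := SGraph (@Q_adj_sym n) (@Q_adj_irrefl n).

(* Main.v *)
Require Import Defs.
From mathcomp Require Import all_boot.
From mathcomp Require Import all_algebra zify.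
Set Implicit Arguments.
Unset Strict Implicit.
Unset Printing Implicit Defensive.

Import GRing.Theory.

(** In a galaxy choose a centre for each star and call every vertex other than
these centres and the vertices missed by the galaxy a leaf. Each edge then
joins a leaf to a non-leaf, and a leaf lies on exactly one edge; so the galaxy
is a partial map sending each leaf to a neighbour that is not a leaf.

Lower bound. Let a 2m-regular graph on N > 0 vertices, with m > 1, be split
into t <= m + 1 galaxies. A vertex that is a leaf in all of them has degree
t < 2m, so every vertex is a non-leaf at least once. Each galaxy has as many
edges as leaves, so there are mN pairs (vertex, galaxy) in which the vertex is
a leaf, and hence (t - m)N pairs in which it is not. Thus t = m + 1 and every
vertex v is a non-leaf exactly once; the other m galaxies contain one edge at v
each, so v has degree m in the galaxy where it is a non-leaf. Counting the
edges of one galaxy F from either end, F has m times as many leaves as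
non-leaves, so m + 1 divides N ([sa_regular_lower_bound]). For the cube of
dimension 2m = 2^k + 2^j - 4 the number m + 1 = 2^(k-1) + 2^(j-1) - 1 is odd
and greater than 1, and does not divide 2^(2m).

Upper bound. First take dimension 2(2^m - 1), and let two coordinates
correspond to each nonzero vector a of V = F_2^m. The syndrome c(x) in V is the
sum of the vectors belonging to the coordinates where x is 1. The edges in the
two directions of a form 4-cycles; orient these cyclically. Every vertex then
has exactly one outgoing edge for each a, and its head has syndrome c(x) + a:
the heads of the edges leaving x have all the syndromes other than c(x), once
each. So the edges whose head has syndrome d form a galaxy with centres the
vertices of syndrome d, and 2^m galaxies suffice. Applying this to two blocks
of coordinates at once, with m = k - 1 and m = j - 1, gives dimension
2^k + 2^j - 4 and 2^(k-1) + 2^(j-1) galaxies ([sa_Q_le]). *)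

(** * Leaves of a galaxy *)

Lemma double_count (T : finType) (F : {set {set T}}) (A : {set T}) :
  \sum_(x in A) #|[set e in F | x \in e]| = \sum_(e in F) #|e :&: A|.
Proof.
transitivity (\sum_(x in A) \sum_(e in F) (x \in e : nat)).
  apply: eq_bigr => x _; rewrite -sum1_card big_mkcond [RHS]big_mkcond /=.
  by apply: eq_bigr => e _; rewrite inE; case: (e \in F); case: (x \in e).
rewrite exchange_big /=; apply: eq_bigr => e _.
rewrite -sum1_card big_mkcond [RHS]big_mkcond /=.
by apply: eq_bigr => x _; rewrite inE andbC; case: (x \in A); case: (x \in e).
Qed.

Lemma cover_star (T : finType) (c : T) (M : {set T}) :
  M != set0 -> cover [set [set c; l] | l in M] = c |: M.
Proof.
case/set0Pn=> l0 l0M; apply/setP=> x; apply/bigcupP/setU1P.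
  by case=> _ /imsetP[l lM ->] /set2P[->|->]; [left | right].
case=> [->|xM]; first by exists [set c; l0]; [exact: imset_f | exact: set21].
by exists [set c; x]; [exact: imset_f | exact: set22].
Qed.

(** Only a centre can have degree above 1 in a galaxy; these three facts put
that structure into a form in which edges can be counted from either end. The
set of leaves is not determined by F, since either end of a one-edge star can be
its centre; hence the existential. *)
Lemma galaxy_leaves (T : finType) (F : {set {set T}}) : galaxy F ->
  exists L : {set T},
    [/\ {in F, forall e, #|e :&: L| = 1}, {in F, forall e, #|e :\: L| = 1}
      & {in L, forall x, #|[set e in F | x \in e]| = 1}].
Proof.
case/existsP=> P /and3P[starP disjP /eqP->].
have /fin_all_exists[c cP] S : exists c : option T, S \in P ->
    if c is Some c then exists M : {set T},
      [/\ M != set0, c \notin M & S = [set [set c; l] | l in M]] else False.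
  case SP: (S \in P); last by exists None.
  have /existsP[c /existsP[M /and3P[? ? /eqP?]]] := forall_inP starP S SP.
  by exists (Some c) => _; exists M.
have coverP S S' x : S \in P -> S' \in P ->
    x \in cover S -> x \in cover S' -> S = S'.
  move=> SP S'P xS xS'; apply/eqP.
  apply: contraTT (forall_inP (forall_inP disjP S SP) S' S'P) => neS.
  rewrite negb_imply neS /=; apply/pred0Pn; exists x.
  by rewrite /= xS xS'.
pose L := \bigcup_(S in P) [set x in cover S | Some x != c S].
have LP S x : S \in P -> x \in cover S -> (x \in L) = (Some x != c S).
  move=> SP xS; apply/bigcupP/idP => [[S' S'P]|xc].
    by rewrite inE => /andP[xS' ]; rewrite (coverP _ _ _ SP S'P xS xS').
  by exists S => //; rewrite inE xS.
have edgeP e : e \in cover P -> exists S z l,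
    [/\ S \in P, e \in S, c S = Some z, e = [set z; l] & z \notin L /\ l \in L].
  case/bigcupP=> S SP eS; have := cP S SP.
  case cS: (c S) => [z|] // [M [M0 zM ES]].
  move: (eS); rewrite {1}ES => /imsetP[l lM ee]; exists S, z, l; split=> //.
  have cov : cover S = z |: M by rewrite ES cover_star.
  rewrite !(LP S) // ?cov ?setU11 ?setU1r // cS eqxx; split=> //.
  by apply: contraNneq zM => -[<-].
exists L; split.
- move=> e /edgeP[S [z [l [_ _ _ -> [zL lL]]]]].
  apply/eqP/cards1P; exists l; apply/setP=> x; rewrite !inE.
  have [->|_] /= := eqVneq x l; first by rewrite orbT lL.
  by case: eqP => // ->; rewrite (negPf zL).
- move=> e /edgeP[S [z [l [_ _ _ -> [zL lL]]]]].
  apply/eqP/cards1P; exists z; apply/setP=> x; rewrite !inE.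
  have [->|_] /= := eqVneq x z; first by rewrite zL.
  by case: eqP => [->|_]; rewrite ?lL ?andbF.
- move=> x xL; case/bigcupP: (xL) => S SP; rewrite inE => /andP[xS _].
  case/bigcupP: (xS) => e eS xe.
  apply/eqP/cards1P; exists e; apply/setP=> e'; rewrite !inE.
  apply/andP/eqP => [[e'P xe']|->]; last by split=> //; apply/bigcupP; exists S.
  have eP : e \in cover P by apply/bigcupP; exists S.
  have leafE e1 : e1 \in cover P -> x \in e1 ->
    exists2 z, c S = Some z & e1 = [set z; x].
    move=> /edgeP[S1 [z [l [S1P e1S1 cS1 e1E [zL lL]]]]] xe1.
    have xS1 : x \in cover S1 by apply/bigcupP; exists e1.
    rewrite (coverP _ _ _ SP S1P xS xS1); exists z => //.
    move: xe1; rewrite e1E => /set2P[xz|->] //.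
    by rewrite -xz xL in zL.
  have [z cz ->] := leafE _ eP xe.
  by have [z' cz' ->] := leafE _ e'P xe'; move: cz; rewrite cz' => -[->].
Qed.

(** * The lower bound for regular graphs *)

Lemma card_incident (G : sgraph) (x : G) :
  #|[set e in edges G | x \in e]| = #|[set y | adj x y]|.
Proof.
rewrite -(card_in_imset (f := fun y => [set x; y])
  (D := mem [set y | adj x y])).
  apply: eq_card => e; rewrite !inE; apply/andP/imsetP.
    case=> /existsP[u /existsP[v /andP[uv /eqP->]]] /set2P[]->.
      by exists v; rewrite ?inE.
    by exists u; rewrite ?inE 1?adj_sym // setUC.
  case=> y; rewrite inE => xy ->; rewrite set21; split=> //.
  by apply/existsP; exists x; apply/existsP; exists y; rewrite xy eqxx.
move=> y z; rewrite !inE => xy xz /setP/(_ y); rewrite !inE eqxx orbT.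
by case/esym/orP=> /eqP // yx; rewrite yx adj_irrefl in xy.
Qed.

Lemma sum_card_partition (T : finType) (P : {set {set T}}) (D : {set T})
    (p : pred T) :
  partition P D ->
  \sum_(F in P) #|[set e in F | p e]| = #|[set e in D | p e]|.
Proof.
case/and3P=> /eqP covP trP _.
have cardE (A : {set T}) : #|[set e in A | p e]| = \sum_(e in A) p e.
  rewrite -sum1_card big_mkcond [RHS]big_mkcond /=.
  by apply: eq_bigr => e _; rewrite inE; case: (e \in A); case: (p e).
rewrite cardE -covP big_trivIset //; apply: eq_bigr => F _; exact: cardE.
Qed.

(** With only m + 1 galaxies all the counting inequalities are equalities, so
every galaxy splits the vertices into leaves and non-leaves in ratio m : 1. *)
Lemma sa_regular_lower_bound (G : sgraph) (m : nat) :
    1 < m -> 0 < #|G| -> (forall x : G, #|[set y | adj x y]| = m.*2) ->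
  ~~ (m.+1 %| #|G|) -> m.+1 < sa G.
Proof.
move=> m1 G0 reg ndvd; rewrite /sa.
case: ex_minnP => t /existsP[P /andP[/andP[partP galP] /eqP cP]] _.
rewrite ltnNge; apply: contra ndvd => tm.
have /fin_all_exists[L LP] F : exists L : {set G}, F \in P ->
    [/\ {in F, forall e, #|e :&: L| = 1}, {in F, forall e, #|e :\: L| = 1}
      & {in L, forall x, #|[set e in F | x \in e]| = 1}].
  case FP: (F \in P); last by exists set0.
  by have [L LF] := galaxy_leaves (forall_inP galP F FP); exists L.
pose deg x (F : {set {set G}}) := #|[set e in F | x \in e]|.
have degE x : \sum_(F in P) deg x F = m.*2.
  rewrite -[RHS](reg x) -card_incident.
  exact: (sum_card_partition (fun e : {set G} => x \in e) partP).
have degL F x : F \in P -> x \in L F -> deg x F = 1.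
  by move=> FP xL; have [_ _] := LP F FP; apply.
have cardL F : F \in P -> #|L F| = #|F|.
  move=> FP; have [L1 _ L2] := LP F FP.
  rewrite -!sum1_card -[RHS](eq_bigr _ L1) -double_count.
  by apply: eq_bigr => x xL; rewrite L2.
have cardC F : F \in P -> \sum_(x in ~: L F) deg x F = #|F|.
  move=> FP; have [_ L1 _] := LP F FP.
  rewrite double_count -sum1_card; apply: eq_bigr => e eF.
  by rewrite -(L1 e eF) setDE.
have sumL : \sum_(F in P) #|L F| = #|G| * m.
  apply: double_inj; rewrite doubleMr -sum_nat_const.
  rewrite -[RHS](eq_bigr _ (fun x _ => degE x)) exchange_big /=.
  rewrite -mul2n big_distrr /=; apply: eq_bigr => F FP.
  rewrite (bigID (mem (L F))) /= (eq_bigr (fun=> 1)); last first.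
    by move=> x /(degL _ _ FP).
  rewrite sum1_card mul2n -addnn {2}cardL // -(cardC F) //; congr (_ + _).
  by apply: eq_bigl => x; rewrite inE.
pose miss x := \sum_(F in P) (x \notin L F).
have miss_gt0 x : 0 < miss x.
  rewrite lt0n; apply/negP => /eqP /eqP; rewrite sum_nat_eq0.
  move=> /forall_inP nomiss.
  have := degE x; rewrite (eq_bigr (fun=> 1)) ?sum1_card ?cP => [|F FP];
    first lia.
  by apply: degL => //; have := nomiss F FP; case: (x \in L F).
(* Each pair (x, F) is counted on the left once, in the first sum if x is not a
   leaf of F and in the second one if it is. *)
have sum_miss : \sum_x miss x + #|G| * m = t * #|G|.
  rewrite /miss exchange_big -sumL -big_split -cP -sum_nat_const /=.
  apply: eq_bigr => F _; rewrite -(cardsC (L F)) addnC; congr (_ + _).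
  rewrite -sum1_card [RHS]big_mkcond /=; apply: eq_bigr => x _.
  by rewrite inE; case: (x \in L F).
have sum_ge : #|G| <= \sum_x miss x by rewrite -sum1_card leq_sum.
have tE : t = m.+1.
  apply/eqP; rewrite eqn_leq tm /= ltnNge; apply/negP => le_tm.
  have := leq_mul le_tm (leqnn #|G|); lia.
have miss1 x : miss x = 1.
  have : \sum_x miss x = \sum_(x : G) 1.
    by rewrite sum1_card; move: sum_miss; rewrite tE mulSn mulnC => /addIn.
  rewrite (bigD1 x) //= [RHS](bigD1 x) //= => E.
  have : \sum_(i | i != x) 1 <= \sum_(i | i != x) miss i by apply: leq_sum.
  have := miss_gt0 x; lia.
have [F FP] : exists F, F \in P by apply/set0Pn; rewrite -card_gt0 cP tE.
have degC x : x \in ~: L F -> deg x F = m.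
  rewrite inE => xL; have := degE x; rewrite (bigD1 F) //=.
  rewrite (eq_bigr (fun=> 1)) => [|F' /andP[F'P neF]].
    have := cP; rewrite -sum1_card (bigD1 F) //= tE add1n => -[->]; lia.
  apply: degL => //; apply: contraTT isT => xL'.
  have := miss1 x; rewrite /miss (bigD1 F) //= (bigD1 F') /=;
    last by rewrite F'P.
  by rewrite xL xL'.
apply/dvdnP; exists #|~: L F|.
have E : #|L F| = #|~: L F| * m.
  by rewrite cardL // -(cardC F) // (eq_bigr _ degC) sum_nat_const.
by rewrite mulnS -E addnC -(cardsC (L F)).
Qed.

(** * Galaxies from leaf-to-centre relations *)

(** Read [r v w] as: v is a leaf of the star with centre w. Under the two
hypotheses the stars with distinct centres are vertex-disjoint. *)
Lemma galaxy_leaf_rel (T : finType) (r : rel T) :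
    (forall v w w', r v w -> r v w' -> w = w') ->
    (forall u v w, r u v -> ~~ r v w) ->
  galaxy [set e : {set T} | [exists v, exists w, r v w && (e == [set w; v])]].
Proof.
move=> fun_r leaf_r.
pose S w := [set [set w; v] | v in [set v | r v w]].
pose C := [set w | [exists v, r v w]].
have nleaf u v w : r u v -> r v w -> False by move=> /leaf_r/negP; apply.
apply/existsP; exists (S @: C).
have covS w : w \in C -> cover (S w) = w |: [set v | r v w].
  by rewrite inE => /existsP[v vw]; rewrite cover_star //; apply/set0Pn;
    exists v; rewrite inE.
apply/and3P; split.
- apply/forall_inP=> _ /imsetP[w wC ->]; rewrite inE in wC.
  case/existsP: wC => v vw.
  apply/existsP; exists w; apply/existsP; exists [set v | r v w].
  rewrite eqxx andbT; apply/andP; split.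
    by apply/set0Pn; exists v; rewrite inE.
  by rewrite inE; exact: leaf_r vw.
- apply/forall_inP=> _ /imsetP[w wC ->].
  apply/forall_inP=> _ /imsetP[w' w'C ->].
  apply/implyP; apply: contraNT => /pred0Pn[x /=].
  rewrite !covS // => /andP[/setU1P xw /setU1P xw'].
  suff -> : w = w' by [].
  move: wC w'C; rewrite !inE => /existsP[v vw] /existsP[v' vw'].
  move: xw xw'; rewrite !inE => -[->|xw] [xE|xw'] //.
  + by case: (nleaf _ _ _ vw xw').
  + by move: xw; rewrite xE => /(nleaf _ _ _ vw').
  + exact: fun_r xw xw'.
- rewrite eqEsubset; apply/andP; split; apply/subsetP=> e.
    rewrite inE => /existsP[v /existsP[w /andP[vw /eqP->]]].
    apply/bigcupP; exists (S w); last by apply: imset_f; rewrite inE.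
    by apply: imset_f; rewrite inE; apply/existsP; exists v.
  case/bigcupP=> _ /imsetP[w _ ->] /imsetP[v]; rewrite inE => vw ->.
  by rewrite inE; apply/existsP; exists v; apply/existsP; exists w;
    rewrite vw eqxx.
Qed.

(** The galaxies given by the relations [r i] may share edges. Restricting
[r i] to some of its pairs preserves the hypotheses of [galaxy_leaf_rel], so
each edge can be kept in just one of the galaxies that contain it. *)
Lemma sa_le_leaf_rel (G : sgraph) (I : finType) (r : I -> rel G) :
    (forall i v w, r i v w -> adj v w) ->
    (forall i v w w', r i v w -> r i v w' -> w = w') ->
    (forall i u v w, r i u v -> ~~ r i v w) ->
    (forall x y, adj x y -> exists i, r i x y || r i y x) ->
  sa G <= #|I|.
Proof.
move=> r_adj fun_r leaf_r cov_r; rewrite /sa; case: ex_minnP => t _ tmin.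
pose col (e : {set G}) :=
  [pick i | [exists v, exists w, r i v w && (e == [set w; v])]].
pose K i := [set e in edges G | col e == Some i].
pose P := preim_partition col (edges G).
have col_edge e : e \in edges G -> exists i, col e = Some i.
  rewrite inE => /existsP[x /existsP[y /andP[xy /eqP->]]].
  rewrite /col; case: pickP => [i _|none]; first by exists i.
  case: (cov_r x y xy) => i /orP[xr|yr].
    by have /existsP[] := none i; exists x; apply/existsP; exists y;
      rewrite xr setUC eqxx.
  by have /existsP[] := none i; exists y; apply/existsP; exists x;
    rewrite yr eqxx.
have PK F : F \in P -> exists i, F = K i.
  case/imsetP=> e eE ->; have [i ei] := col_edge e eE; exists i.
  by apply/setP=> f; rewrite !inE ei eq_sym.
have galK i : galaxy (K i).
  pose r' v w := r i v w && (col [set w; v] == Some i).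
  have -> : K i =
      [set e : {set G} | [exists v, exists w, r' v w && (e == [set w; v])]].
    apply/setP=> e; rewrite !inE; apply/andP/existsP.
      case=> _ eK; move: (eK); rewrite /col.
      case: pickP => // i' /existsP[v /existsP[w]].
      case/andP=> vw /eqP ee /eqP[ii]; subst i'.
      by exists v; apply/existsP; exists w; rewrite /r' vw -ee eK eqxx.
    case=> v /existsP[w /andP[/andP[vw cw] /eqP->]]; split=> //.
    by apply/existsP; exists w; apply/existsP; exists v;
      rewrite adj_sym (r_adj _ _ _ vw) eqxx.
  apply: galaxy_leaf_rel => [v w w' /andP[vw _] /andP[vw' _]|u v w /andP[uv _]].
    exact: fun_r vw vw'.
  by rewrite negb_and (leaf_r _ _ _ _ uv).
apply: (@leq_trans #|P|).
  apply: tmin; apply/existsP; exists P; rewrite eqxx andbT.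
  apply/andP; split; first exact: preim_partitionP.
  by apply/forall_inP=> F /PK[i ->].
apply: leq_trans (leq_imset_card K I); apply: subset_leq_card.
by apply/subsetP=> F /PK[i ->]; exact: imset_f.
Qed.

(** * The hypercube *)

Definition flip n (x : n.-tuple bool) (i : 'I_n) : n.-tuple bool :=
  [tuple tnth x l (+) (l == i) | l < n].

Lemma tnth_flip n (x : n.-tuple bool) i l :
  tnth (flip x i) l = tnth x l (+) (l == i).
Proof. by rewrite tnth_mktuple. Qed.

Lemma flipK n (i : 'I_n) : involutive ((@flip n)^~ i).
Proof.
move=> x; apply: eq_from_tnth => l.
by rewrite !tnth_flip -addbA addbb addbF.
Qed.

Lemma flip_inj n (x : n.-tuple bool) : injective (flip x).
Proof.
move=> i l /(congr1 (fun y => tnth y i)); rewrite !tnth_flip eqxx => /addbI.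
by move/esym/eqP.
Qed.

Lemma Q_adjP n (x y : Q n) : reflect (exists i, y = flip x i) (adj x y).
Proof.
apply: (iffP cards1P) => -[i].
  move=> E; exists i; apply: eq_from_tnth => l; rewrite tnth_flip.
  move/setP/(_ l): E; rewrite !inE => <-.
  by case: (tnth x l); case: (tnth y l).
move=> ->; exists i; apply/setP=> l; rewrite !inE tnth_flip.
by case: (tnth x l); case: (l == i).
Qed.

Lemma Q_regular n (x : Q n) : #|[set y | adj x y]| = n.
Proof.
rewrite -[RHS]card_ord -(card_imset _ (@flip_inj n x)).
apply: eq_card => y; rewrite inE; apply/Q_adjP/imsetP.
  by case=> i ->; exists i.
by case=> i _ ->; exists i.
Qed.

(** * Decomposition by syndromes *)

Section Construction.
Variables (B : finType) (m : B -> nat).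

(** A colour is a block b together with a vector of the space of that block.
It serves as the index of a galaxy and, if the vector is nonzero, as the common
label of two coordinates, which the boolean in [coord] tells apart. *)
Local Notation colour := {b : B & 'rV['F_2]_(m b)}.
Local Notation nzcolour := {u : colour | tagged u != 0%R}.
Local Notation coord := (nzcolour * bool)%type.

Lemma card_colour : #|{: colour}| = \sum_b 2 ^ m b.
Proof.
rewrite card_tagged sumnE big_map big_enum /=.
by apply: eq_bigr => b _; rewrite card_mx card_Fp // mul1n.
Qed.

Lemma card_coord : #|{: coord}| = \sum_b (2 ^ m b - 1).*2.
Proof.
rewrite card_prod card_bool card_sig muln2 -sum1_card.
rewrite (eq_bigl (fun u : colour => true && (tagged u != 0%R))) //.
rewrite -(sig_big_dep predT (fun b (a : 'rV['F_2]_(m b)) => a != 0%R)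
  (fun _ _ => 1)) /=.
rewrite -mul2n big_distrr /=; apply: eq_bigr => b _.
rewrite mul2n sum1_card; congr _.*2.
by rewrite (cardC1 (0%R : 'rV['F_2]_(m b))) card_mx card_Fp // mul1n subn1.
Qed.

Local Notation n := #|{: coord}|.
Implicit Types (x y v w : Q n) (l : 'I_n) (b : B).

Definition label l : colour := val (enum_val l).1.

(** The projection to block b of the direct sum of the spaces of all blocks;
it is zero on the colours of the other blocks. *)
Definition component b (u : colour) : 'rV['F_2]_(m b) :=
  untag (T_ := fun b => 'rV['F_2]_(m b)) 0%R (fun a => a) u.

Definition syndrome x b : 'rV['F_2]_(m b) :=
  (\sum_(l < n) component b (label l) *+ tnth x l)%R.

(** The sum of the two bits of x at the coordinates labelled u. Flipping the
first of them if this sum is 0 and the second if it is 1 runs through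
00, 10, 11, 01, a cyclic orientation of the 4-cycle. *)
Definition parity x (u : nzcolour) : bool :=
  \big[addb/false]_(l < n | (enum_val l).1 == u) tnth x l.

(** The edge from x to y, flipping coordinate l, is oriented towards y by the
rule for 4-cycles, the block of l is that of i, and y is a centre in
galaxy i: its syndrome in that block is the vector of i. *)
Definition points_to (i : colour) x y : bool :=
  [exists l, [&& y == flip x l, tag (label l) == tag i,
     syndrome y (tag i) == tagged i
     & parity x (enum_val l).1 == (enum_val l).2]].

Lemma syndrome_flip x l b :
  syndrome (flip x l) b = (syndrome x b + component b (label l))%R.
Proof.
rewrite /syndrome (bigD1 l) //= [in RHS](bigD1 l) //= tnth_flip eqxx addbT.
rewrite (eq_bigr (fun l' => component b (label l') *+ tnth x l')%R); last first.
  by move=> l' /negPf ne; rewrite tnth_flip ne addbF.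
have char2 : (component b (label l) + component b (label l) = 0)%R.
  by apply/rowP=> t; rewrite !mxE addrr_pchar2 // pchar_Fp.
case: (tnth x l) => /=; last by rewrite mulr1n mulr0n add0r addrC.
by rewrite mulr0n mulr1n add0r addrAC char2 add0r.
Qed.

(** Since the parity differs at the two ends of an edge, the rule for 4-cycles
holds at exactly one of them: each edge gets exactly one orientation. *)
Lemma parity_flip x l :
  parity (flip x l) (enum_val l).1 = ~~ parity x (enum_val l).1.
Proof.
rewrite /parity (bigD1 l) //= [in RHS](bigD1 l) //= tnth_flip eqxx addbT addNb.
congr (~~ (_ (+) _)); apply: eq_bigr => l' /andP[_ /negPf ne].
by rewrite tnth_flip ne addbF.
Qed.

Lemma component_tag u : component (tag u) u = tagged u.
Proof. by rewrite /component untagE. Qed.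

Lemma component_inj b u u' : tag u = b -> tag u' = b ->
  component b u = component b u' -> u = u'.
Proof.
move=> e e'; rewrite /component !untagE => E.
by rewrite -(etaggedK e) -(etaggedK e') E.
Qed.

(** The galaxy and the syndrome of a leaf determine the label of its edge, and
its parity there determines the coordinate. A centre of galaxy i cannot be a
leaf of it: its edge would join two vertices with the same syndrome in the
block of i, but flipping a coordinate of that block adds a nonzero vector. *)
Lemma sa_Q_le : sa (Q n) <= \sum_b 2 ^ m b.
Proof.
rewrite -card_colour; apply: (sa_le_leaf_rel (r := points_to)).
- by move=> i v w /existsP[l /and4P[/eqP-> _ _ _]]; apply/Q_adjP; exists l.
- move=> i v w w' /existsP[l /and4P[/eqP-> /eqP tl sl /eqP pl]].
  case/existsP=> l' /and4P[/eqP-> /eqP tl' sl' /eqP pl'].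
  congr flip; apply: enum_val_inj.
  move: sl; rewrite -(eqP sl') !syndrome_flip.
  move=> /eqP/addrI /(component_inj tl tl') /val_inj El; move: El pl pl'.
  by case: (enum_val l) (enum_val l') => [u s] [u' s'] /= -> -> ->.
- move=> i u v w /existsP[l /and4P[_ _ /eqP sv _]].
  apply/existsP=> -[l' /and4P[/eqP-> /eqP tl' + _]].
  rewrite syndrome_flip sv -[X in _ == X]addr0 => /eqP/addrI.
  by rewrite -tl' component_tag => /eqP; apply/negP/(valP (enum_val l').1).
- move=> x y /Q_adjP[l ->].
  pose i z : colour :=
    Tagged (fun b => 'rV['F_2]_(m b)) (syndrome z (tag (label l))).
  have [px|px] := boolP (parity x (enum_val l).1 == (enum_val l).2).
    exists (i (flip x l)); apply/orP; left; apply/existsP; exists l.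
    by rewrite !eqxx px.
  exists (i x); apply/orP; right; apply/existsP; exists l.
  rewrite flipK !eqxx parity_flip /=; move: px.
  by case: (parity _ _); case: (enum_val l).2.
Qed.

End Construction.

Theorem proposition1 (k j : nat) (hj : 2 <= j) (hkj : j <= k) :
  sa (Q (2 ^ k + 2 ^ j - 4)) = 2 ^ (k - 1) + 2 ^ (j - 1).
Proof.
have dbl i : 2 <= i ->
  2 ^ i = (2 ^ (i - 1)).*2 /\ exists c, 2 ^ (i - 1) = c.*2.+2.
  case: i => [|[|i]] // _; rewrite subSS subn0 -mul2n -expnS; split=> //.
  exists (2 ^ i - 1); rewrite expnS; have := expn_gt0 2 i; lia.
have [Ej [c Ec]] := dbl j hj; have [Ek [d Ed]] := dbl k (leq_trans hj hkj).
apply/eqP; rewrite eqn_leq; apply/andP; split.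
  have := sa_Q_le (fun b : bool => if b then k - 1 else j - 1).
  rewrite card_coord !big_bool /= (_ : _ + _ = 2 ^ k + 2 ^ j - 4) //; lia.
rewrite Ek Ej (_ : _ - 4 = (2 ^ (k - 1) + 2 ^ (j - 1) - 2).*2); last lia.
set m := _ + _ - 2.
have -> : 2 ^ (k - 1) + 2 ^ (j - 1) = m.+2 by lia.
have m1 : 1 < m by lia.
have cardQ : #|Q m.*2| = 2 ^ m.*2 by rewrite card_tuple card_bool.
apply: sa_regular_lower_bound => //; first by rewrite cardQ expn_gt0.
  exact: Q_regular.
rewrite cardQ; apply: contraL m1 => dv.
have : coprime m.+1 (2 ^ m.*2) by rewrite coprimeXr // coprimen2; lia.
rewrite /coprime (gcdn_idPl dv); lia.
Qed.
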